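(* Let $i\in[d]$, let $S$ be any subset of $\Pi_d=\{0,1\}^d$ with $\mathrm{flip}(x,i)\notin S$ for all $x\in S$, and consider any $0<p<q<1$. Then, for any Boolean distribution $\mathcal{D}_{-i}$ on $\{0,1\}^{[d]\setminus\{i\}}$ with $\mathcal{D}_{-i}(S_{-i})\in(0,1)$, there exists a distribution $\mathcal{D}'_{-i}$ on $\{0,1\}^{[d]\setminus\{i\}}$ such that $(\mathrm{Be}(p)\otimes\mathcal{D}_{-i})_S\equiv(\mathrm{Be}(q)\otimes\mathcal{D}'_{-i})_S$.
   Context: For $x\in\Pi_d$ and $i\in[d]$: $\mathrm{flip}(x,i)$ denotes $x$ with its $i$-th coordinate flipped; $x_{-i}$ is $x$ with the $i$-th coordinate removed; $(x_{-i},y)$ is $x$ with $x_i$ replaced by $y$. $S_{-i}=\{x_{-i}:(x_{-i},0)\in S\ \text{or}\ (x_{-i},1)\in S\}$ is the projection of $S$. $\mathrm{Be}(p)$ is the Bernoulli distribution with parameter $p$. $\mathrm{Be}(p)\otimes\mathcal{D}_{-i}$ is the distribution on $\Pi_d$ in which the $i$-th coordinate is distributed as $\mathrm{Be}(p)$, independently of the remaining coordinates, which are jointly distributed as $\mathcal{D}_{-i}$ (an arbitrary, not necessarily product, distribution). For a distribution $\mathcal{P}$ on $\Pi_d$, $\mathcal{P}_S$ denotes its truncation by $S$: $\mathcal{P}_S(x)=\mathcal{P}(x)/\mathcal{P}(S)$ for $x\in S$ and $0$ otherwise. $\equiv$ denotes equality of distributions. *)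

(* Defs.v *)
(* Finite probability distributions on the Boolean hypercube, given by their
   mass functions. The points of {0,1}^d are the finite functions
   'I_d -> bool, with 1 encoded as true and 0 as false. *)
From HB Require Import structures.
From mathcomp Require Import all_boot all_order all_algebra.
From mathcomp Require Import reals interval_inference bernoulli_distribution.

Set Implicit Arguments.
Unset Strict Implicit.
Unset Printing Implicit Defensive.

Import Order.TTheory GRing.Theory Num.Theory.
Local Open Scope ring_scope.

Section Hypercube.
Variable d : nat.

Definition cube := {ffun 'I_d -> bool}.

(* {0,1}^([d] \ {i}) *)
Definition cubeD1 (i : 'I_d) := {ffun {j : 'I_d | j != i} -> bool}.

Definition flip (x : cube) (i : 'I_d) : cube :=
  [ffun j => if j == i then ~~ x j else x j].

(* x_{-i} *)
Definition drop_coord (i : 'I_d) (x : cube) : cubeD1 i :=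
  [ffun j => x (val j)].

(* (y, b) for y indexed by [d] \ {i}: coordinate i is b, the others are y's. *)
Definition with_coord (i : 'I_d) (y : cubeD1 i) (b : bool) : cube :=
  [ffun j => if insub j is Some k then y k else b].

(* S_{-i} *)
Definition proj_set (i : 'I_d) (S : {set cube}) : {set cubeD1 i} :=
  [set y | (with_coord y false \in S) || (with_coord y true \in S)].

Lemma drop_coordK (i : 'I_d) (x : cube) : with_coord (drop_coord i x) (x i) = x.
Proof.
apply/ffunP => j; rewrite ffunE; case: insubP => [k _ <-|]; first by rewrite ffunE.
by rewrite negbK => /eqP->.
Qed.

Lemma with_coordK (i : 'I_d) (y : cubeD1 i) b : drop_coord i (with_coord y b) = y.
Proof. by apply/ffunP => j; rewrite !ffunE valK. Qed.

Lemma with_coord_at (i : 'I_d) (y : cubeD1 i) b : with_coord y b i = b.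
Proof. by rewrite ffunE insubF ?eqxx. Qed.

End Hypercube.

Section Distributions.
Variable R : realType.

Record distribution (T : finType) := Distribution {
  mass :> {ffun T -> R};
  massP : [forall x, 0 <= mass x] && (\sum_x mass x == 1) }.

HB.instance Definition _ (T : finType) := [isSub for @mass T].

Definition Pr (T : finType) (P : distribution T) (A : {set T}) : R :=
  \sum_(x in A) P x.

Lemma mass_ge0 (T : finType) (P : distribution T) x : 0 <= P x.
Proof. by have /andP[/forallP/(_ x)] := massP P. Qed.

Lemma mass_sum1 (T : finType) (P : distribution T) : \sum_x P x = 1.
Proof. by have /andP[_ /eqP] := massP P. Qed.

Lemma Be_subproof (p : {i01 R}) (f := [ffun b => bernoulli_pmf p%:num b]) :
  [forall b, 0 <= f b] && (\sum_b f b == 1).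
Proof.
apply/andP; split.
  by apply/forallP => b; rewrite ffunE bernoulli_pmf_ge0 // ge0 le1.
by rewrite big_bool !ffunE /bernoulli_pmf /= addrC subrK.
Qed.

Definition Be (p : {i01 R}) : distribution bool := Distribution (Be_subproof p).

Lemma prod_subproof (d : nat) (i : 'I_d) (B : distribution bool)
    (D : distribution (cubeD1 i))
    (f := [ffun x : cube d => B (x i) * D (drop_coord i x)]) :
  [forall x, 0 <= f x] && (\sum_x f x == 1).
Proof.
apply/andP; split.
  by apply/forallP => x; rewrite ffunE mulr_ge0 ?mass_ge0.
have bij : bijective (fun u : bool * cubeD1 i => with_coord u.2 u.1).
  exists (fun x : cube d => (x i, drop_coord i x)) => [[b y]|x] /=.
    by rewrite with_coordK with_coord_at.
  exact: drop_coordK.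
apply/eqP; rewrite (reindex _ (onW_bij _ bij)) /=.
under eq_bigr => u _ do rewrite ffunE with_coordK with_coord_at.
rewrite -(pair_bigA _ (fun b y => B b * D y)) /=.
under eq_bigr => b _ do rewrite -big_distrr /= mass_sum1 mulr1.
exact: mass_sum1.
Qed.

(* Coordinate i has law B, independently of the remaining coordinates, whose
   joint law is D. *)
Definition prod_at (d : nat) (i : 'I_d) (B : distribution bool)
    (D : distribution (cubeD1 i)) : distribution (cube d) :=
  Distribution (prod_subproof B D).

Lemma trunc_subproof (T : finType) (P : distribution T) (S : {set T})
    (PS : 0 < Pr P S)
    (f := [ffun x => if x \in S then P x / Pr P S else 0]) :
  [forall x, 0 <= f x] && (\sum_x f x == 1).
Proof.
apply/andP; split.
  apply/forallP => x; rewrite ffunE; case: ifP => // _.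
  by rewrite divr_ge0 ?mass_ge0 // ltW.
under eq_bigr do rewrite ffunE.
by rewrite -big_mkcond -big_distrl /= divff // gt_eqF.
Qed.

(* P_S, which is a distribution only when P(S) > 0. *)
Definition trunc (T : finType) (P : distribution T) (S : {set T})
    (PS : 0 < Pr P S) : distribution T :=
  Distribution (trunc_subproof PS).

End Distributions.

(* Main.v *)
(* Since S contains at most one point of each fibre of x |-> x_{-i}, the value
   of coordinate i on S is a function b of the other coordinates y. Reweighting
   D by Be(p)(b y) / Be(q)(b y) and normalizing gives a D' for which the two
   product measures are proportional on S, so their truncations coincide. *)
Require Import Defs.
From mathcomp Require Import all_boot all_order all_algebra.
From mathcomp Require Import reals interval_inference bernoulli_distribution.

Import Order.TTheory GRing.Theory Num.Theory.
Local Open Scope ring_scope.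

Lemma normalized_distribution (R : realType) (T : finType) (w : T -> R) :
    (forall x, 0 <= w x) -> 0 < \sum_x w x ->
  exists P : distribution R T, forall x, P x = w x / \sum_y w y.
Proof.
move=> w_ge0 sum_gt0.
pose f := [ffun x => w x / \sum_y w y].
have fP : [forall x, 0 <= f x] && (\sum_x f x == 1).
  apply/andP; split.
    by apply/forallP => x; rewrite ffunE divr_ge0 // ltW.
  under eq_bigr do rewrite ffunE.
  by rewrite -big_distrl /= divff // gt_eqF.
by exists (Distribution fP) => x; rewrite ffunE.
Qed.

(** Summing over [S] shows that [Pr] scales by the same [c], which therefore cancels in the
    quotients; [c] is nonzero because [Pr Q S] is positive. *)
Lemma eq_trunc (R : realType) (T : finType) (P Q : distribution R T)
    (S : {set T}) (c : R) (PS : 0 < Pr P S) (QS : 0 < Pr Q S) :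
  (forall x, x \in S -> Q x = P x * c) -> trunc PS = trunc QS.
Proof.
move=> QE.
have QSE : Pr Q S = Pr P S * c by rewrite /Pr (eq_bigr _ QE) -big_distrl.
have c_neq0 : c != 0.
  by apply: contraTneq QS => c0; rewrite QSE c0 mulr0 ltxx.
apply/val_inj/ffunP => x; rewrite !ffunE; case: ifP => // xS.
by rewrite QE // QSE -mulf_div divff // mulr1.
Qed.

Lemma mass_Be_gt0 (R : realType) (p : {i01 R}) b :
  0 < p%:num -> p%:num < 1 -> 0 < Be p b.
Proof. by move=> p0 p1; rewrite ffunE /bernoulli_pmf; case: b; rewrite ?subr_gt0. Qed.

Lemma with_coord_neg (d : nat) (i : 'I_d) (x : cube d) :
  with_coord (drop_coord i x) (~~ x i) = flip x i.
Proof.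
apply/ffunP => j; rewrite !ffunE; case: insubP => [k kP <-|].
  by rewrite ffunE (negPf (valP k)).
by rewrite negbK => /eqP->; rewrite eqxx.
Qed.

(** The fibre over [drop_coord i x] is [x] and [flip x i], and only [x] lies in [S]. A membership
    test on the other coordinates thus recovers [x i]. *)
Lemma coord_in_flip_free (d : nat) (i : 'I_d) (S : {set cube d}) (x : cube d) :
    (forall x, x \in S -> flip x i \notin S) -> x \in S ->
  (with_coord (drop_coord i x) true \in S) = x i.
Proof.
move=> hS xS; have := drop_coordK i x; have := with_coord_neg _ i x.
case: (x i) => /= nE E; first by rewrite E.
by rewrite nE; apply/negbTE/hS.
Qed.

Lemma psumr_gt0 (R : realType) (T : finType) (A : {pred T}) (f : T -> R) x :
    (forall y, y \in A -> 0 <= f y) -> x \in A -> 0 < f x ->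
  0 < \sum_(y in A) f y.
Proof.
move=> f_ge0 xA fx_gt0; rewrite (bigD1 x) //=.
by apply: ltr_pwDl => //; apply: sumr_ge0 => y /andP[/f_ge0].
Qed.

Lemma Pr_gt0P (R : realType) (T : finType) (P : distribution R T) (A : {set T}) :
  reflect (exists2 x, x \in A & 0 < P x) (0 < Pr P A).
Proof.
apply: (iffP idP) => [/lt0r_neq0/eqP/psumr_neq0P|[x xA Px]].
  by case=> [x _|x /andP[xA Px]]; [apply: mass_ge0 | exists x].
by apply: psumr_gt0 xA Px => y _; apply: mass_ge0.
Qed.

Theorem lemma1 (R : realType) (d : nat) (i : 'I_d) (S : {set cube d})
    (hS : forall x, x \in S -> flip x i \notin S)
    (p q : {i01 R})
    (hp : 0 < p%:num) (hpq : p%:num < q%:num) (hq : q%:num < 1)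
    (D : distribution R (cubeD1 i))
    (hD : 0 < Pr D (proj_set i S) < 1) :
  exists (D' : distribution R (cubeD1 i))
         (PS : 0 < Pr (prod_at (Be p) D) S)
         (QS : 0 < Pr (prod_at (Be q) D') S),
    trunc PS = trunc QS.
Proof.
have Bp b : 0 < Be p b by apply: mass_Be_gt0 => //; apply: lt_trans hq.
have Bq b : 0 < Be q b by apply: mass_Be_gt0 => //; apply: lt_trans hpq.
(* The test yields coordinate [i] of the point of [S] above [y]; off the projection it gives the
   default [false], which no point of [S] sees. *)
pose r (y : cubeD1 i) :=
  Be p (with_coord y true \in S) / Be q (with_coord y true \in S).
have r_gt0 y : 0 < r y by rewrite divr_gt0.
have w_ge0 y : 0 <= r y * D y by rewrite mulr_ge0 ?mass_ge0 ?ltW.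
(* This one atom [y], lifted to [S], witnesses that the normalizer and both truncation denominators
   are positive. *)
have /andP[/Pr_gt0P[y yS Dy] _] := hD.
have [b ybS] : exists b, with_coord y b \in S.
  by move: yS; rewrite inE => /orP[]; [exists false | exists true].
have Z_gt0 : 0 < \sum_z r z * D z.
  by apply: (psumr_gt0 _ _ predT _ y) => //; rewrite mulr_gt0.
have [D' D'E] := normalized_distribution _ _ _ w_ge0 Z_gt0.
have D'y : 0 < D' y by rewrite D'E divr_gt0 // mulr_gt0.
have PS : 0 < Pr (prod_at (Be p) D) S.
  apply/Pr_gt0P; exists (with_coord y b) => //.
  by rewrite ffunE with_coordK with_coord_at mulr_gt0.
have QS : 0 < Pr (prod_at (Be q) D') S.
  apply/Pr_gt0P; exists (with_coord y b) => //.
  by rewrite ffunE with_coordK with_coord_at mulr_gt0.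
(* On [S] the factor [Be q (x i)] cancels the denominator of [r], so only the normalizer of [D']
   separates the two products. *)
exists D', PS, QS; apply: (eq_trunc _ _ _ _ _ (\sum_z r z * D z)^-1) => x xS.
have -> : prod_at (Be q) D' x = Be q (x i) * D' (drop_coord i x) by rewrite ffunE.
have -> : prod_at (Be p) D x = Be p (x i) * D (drop_coord i x) by rewrite ffunE.
by rewrite D'E /r coord_in_flip_free // !mulrA [Be q _ * _]mulrC mulfK ?gt_eqF.
Qed.
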